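(* Let $f(x)=x^TAx+2a^Tx+c$ and $h(x)=x^TBx+2b^Tx+d$ be quadratic functions on $\mathbb{R}^n$, where $A,B$ are real symmetric $n\times n$ matrices, $a,b\in\mathbb{R}^n$ and $c,d\in\mathbb{R}$. Suppose that $h$ takes both positive and negative values, i.e. there are $x',x''\in\mathbb{R}^n$ with $h(x')<0<h(x'')$. Consider the two statements: $(\mathrm{E}_1)$ for all $x\in\mathbb{R}^n$, $h(x)=0$ implies $f(x)\ge 0$; $(\mathrm{E}_2)$ there exists $\mu\in\mathbb{R}$ such that $f(x)+\mu h(x)\ge 0$ for all $x\in\mathbb{R}^n$. Then $(\mathrm{E}_1)$ and $(\mathrm{E}_2)$ are equivalent, except precisely in the case in which $A$ has exactly one negative eigenvalue, $B=0$, $b\neq 0$ and $$\left[\begin{array}{cc}V^TAV & V^T(Ax_0+a)\\ (x_0^TA+a^T)V & f(x_0)\end{array}\right]\succeq 0,$$ where $x_0=-\frac{d}{2b^Tb}\,b$ and $V\in\mathbb{R}^{n\times(n-1)}$ is a matrix whose columns form a basis of $\mathcal{N}(b)=\{x\in\mathbb{R}^n: b^Tx=0\}$. That is, $(\mathrm{E}_1)$ and $(\mathrm{E}_2)$ fail to be equivalent if and only if all of these conditions hold.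
   Context: $X\succeq 0$ means that the symmetric matrix $X$ is positive semidefinite. ''Exactly one negative eigenvalue'' is counted with multiplicity. $(\mathrm{E}_1)$ and $(\mathrm{E}_2)$ are called equivalent (for the given pair $(f,h)$) if they are both true or both false. If $n=1$, $V$ has no columns and the displayed matrix is the $1\times 1$ matrix $[f(x_0)]$. *)

(* Defs.v *)
From mathcomp Require Import all_boot all_order all_algebra.
From mathcomp Require Import reals.
Set Implicit Arguments.
Unset Strict Implicit.
Unset Printing Implicit Defensive.
Import Order.TTheory GRing.Theory Num.Theory.
Local Open Scope ring_scope.

(* Vectors of R^n are column vectors; a product of shape 1 x 1 is read as a
   scalar through its only entry. *)
Definition quadfun (R : realType) (n : nat)
    (A : 'M[R]_n) (a : 'cV[R]_n) (c : R) (x : 'cV[R]_n) : R :=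
  (x^T *m A *m x) 0 0 + 2 * (a^T *m x) 0 0 + c.

Definition psdmx (R : realType) (n : nat) (M : 'M[R]_n) : Prop :=
  M^T = M /\ forall x : 'cV[R]_n, 0 <= (x^T *m M *m x) 0 0.

(* Multiplicities are algebraic.  [eigenvalue] is defined through row
   eigenvectors; for a square matrix these have the same eigenvalues. *)
Definition one_neg_eigenvalue (R : realType) (n : nat) (A : 'M[R]_n) : Prop :=
  exists l : R,
    [/\ l < 0, eigenvalue A l, mup l (char_poly A) = 1%N
      & forall m : R, m < 0 -> eigenvalue A m -> m = l].

(* The columns of [V], i.e. the rows of [V^T], are linearly independent and
   span the null space of b^T; the row space of [kermx b] is
   {u | u *m b = 0} = {x^T | b^T *m x = 0}. *)
Definition cols_basis_null (R : realType) (n k : nat)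
    (b : 'cV[R]_n) (V : 'M[R]_(n, k)) : Prop :=
  row_free V^T /\ (V^T == kermx b)%MS.

Definition basepoint (R : realType) (n : nat) (b : 'cV[R]_n) (d : R) :
    'cV[R]_n :=
  - (d / (2 * (b^T *m b) 0 0)) *: b.

Definition bordered_mx (R : realType) (n k : nat) (A : 'M[R]_n)
    (a : 'cV[R]_n) (c : R) (V : 'M[R]_(n, k)) (x0 : 'cV[R]_n) :
    'M[R]_(k + 1) :=
  block_mx (V^T *m A *m V)             (V^T *m (A *m x0 + a))
           ((x0^T *m A + a^T) *m V)    (quadfun A a c x0)%:M.

(* Main.v *)
(* Only (E1) => (E2) can fail. Call z a null direction of B if z^T B z = 0.
   If z^T A z >= 0 for all null directions z, then (E1) extends to the
   homogenizations F, H on R^(n+1): F >= 0 wherever H = 0. Splitting a plane on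
   which H is indefinite along its two null lines gives
   -F(X)/H(X) <= -F(Y)/H(Y) whenever H(Y) < 0 < H(X), so
   mu = sup {-F(X)/H(X) : H(X) > 0} works in (E2).
   If B <> 0, then (E1) forces z^T A z >= 0 for all null directions z, because z
   is a limit direction of the zero set of h: the line w + R z meets it at
   r = -h(w) / (2 (z^T B w + b^T z)), and w can be moved so that r blows up.
   Hence (E1) without (E2) leaves B = 0, b <> 0 and some z with z^T A z < 0;
   then (E1) says that f >= 0 on a hyperplane, which is the bordered condition,
   and A is positive semidefinite on that hyperplane's direction but not
   everywhere, so it has exactly one negative eigenvalue. Conversely, B = 0 and
   z^T A z < 0 exclude (E2), since f + mu h has the quadratic part of A. *)

Require Import Defs.
From mathcomp Require Import all_boot all_order all_algebra.
From mathcomp Require Import reals.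
From mathcomp Require Import polydiv mxred sesquilinear spectral complex.
From mathcomp Require Import classical_sets boolp.
From mathcomp Require Import ring lra.
Import Order.TTheory GRing.Theory Num.Theory.
Local Open Scope ring_scope.
Set Implicit Arguments.
Unset Strict Implicit.

(** * Bilinear forms of matrices *)

Section BilinearForm.
Context {R : comPzRingType} {n : nat}.
Implicit Types (M : 'M[R]_n) (x y z : 'cV[R]_n).

Definition bform M x y : R := (x^T *m M *m y) 0 0.

Lemma bformDl M x y z : bform M (x + y) z = bform M x z + bform M y z.
Proof. by rewrite /bform linearD /= !mulmxDl mxE. Qed.

Lemma bformDr M x y z : bform M x (y + z) = bform M x y + bform M x z.
Proof. by rewrite /bform mulmxDr mxE. Qed.

Lemma bformZl M k x y : bform M (k *: x) y = k * bform M x y.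
Proof. by rewrite /bform linearZ /= -!scalemxAl mxE. Qed.

Lemma bformZr M k x y : bform M x (k *: y) = k * bform M x y.
Proof. by rewrite /bform -!scalemxAr mxE. Qed.

Lemma bformC M x y : M^T = M -> bform M x y = bform M y x.
Proof.
move=> symM; have -> : bform M x y = (x^T *m M *m y)^T 0 0 by rewrite mxE.
by rewrite !trmx_mul trmxK symM mulmxA.
Qed.

End BilinearForm.

(** * Polynomial inequalities in one variable *)

Lemma poly_ge0_at0 (R : realFieldType) (p : {poly R}) :
  (forall e, e != 0 -> 0 <= p.[e]) -> 0 <= p.[0].
Proof.
move=> p_ge0; rewrite leNgt; apply/negP => p0_lt0.
have [q def_p] : exists q, p = q * 'X + p.[0]%:P.
  have /factor_theorem[q def_q] : root (p - p.[0]%:P) 0.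
    by rewrite rootE !hornerE subrr.
  by exists q; move: def_q; rewrite subr0 => <-; rewrite subrK.
have [ub q_ub] := poly_disk_bound q 1.
pose M := Num.max ub 1.
have M_ge1 : 1 <= M by rewrite /M le_max lexx orbT.
have M_gt0 : 0 < M by lra.
(* This size gives [|q.[e] * e| <= - p.[0] / 2], hence [p.[e] < 0]. *)
pose e := Num.min 1 (- p.[0] / (2 * M)).
have e_gt0 : 0 < e.
  by rewrite /e lt_min ltr01 divr_gt0 ?oppr_gt0 // mulr_gt0.
have := p_ge0 e (lt0r_neq0 e_gt0); rewrite def_p !hornerE.
have e_le1 : `|e| <= 1 by rewrite gtr0_norm // /e ge_min lexx.
have qe : `|q.[e]| <= M by rewrite (le_trans (q_ub e e_le1)) // /M le_max lexx.
have : `|q.[e] * e| <= M * (- p.[0] / (2 * M)).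
  rewrite normrM ler_pM // gtr0_norm // /e ge_min lexx orbT //.
have -> : M * (- p.[0] / (2 * M)) = - p.[0] / 2 by field; rewrite gt_eqF.
move=> /(le_trans (ler_norm _)); lra.
Qed.

(** The substitution [r = e^-1] turns growth at infinity into the value at 0 of the reversed
    polynomial. *)
Lemma quadratic_lead_ge0 (R : realFieldType) (u v w : R) :
  (forall r, 0 <= u * r ^+ 2 + v * r + w) -> 0 <= u.
Proof.
move=> ge0; pose p : {poly R} := u%:P + v *: 'X + w *: 'X^2.
have pE e : p.[e] = u + v * e + w * e ^+ 2 by rewrite /p !hornerE.
have -> : u = p.[0] by rewrite pE; ring.
apply: poly_ge0_at0 => e e0; rewrite pE.
have -> : u + v * e + w * e ^+ 2 = e ^+ 2 * (u * e^-1 ^+ 2 + v * e^-1 + w).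
  by field.
by rewrite mulr_ge0 ?sqr_ge0.
Qed.

(* The roots of a + 2 g s - b s^2 are s1 and -s2. *)
Lemma opposite_sign_roots (R : rcfType) (a b g : R) : 0 < a -> 0 < b ->
  exists s1 s2, [/\ 0 < s1, 0 < s2, a + 2 * s1 * g - s1 ^+ 2 * b = 0,
    a - 2 * s2 * g - s2 ^+ 2 * b = 0 & s1 * s2 * b = a].
Proof.
move=> a0 b0; set D := g ^+ 2 + a * b.
have D0 : 0 <= D by rewrite addr_ge0 ?sqr_ge0 ?mulr_ge0 ?ltW.
have sD : Num.sqrt D ^+ 2 = D by rewrite sqr_sqrtr.
have ltgD : `|g| < Num.sqrt D.
  rewrite -(ltr_pXn2r (n := 2)) ?nnegrE ?sqrtr_ge0 // sD /D.
  by rewrite real_normK ?num_real // ltrDl mulr_gt0.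
have : g < Num.sqrt D /\ - g < Num.sqrt D.
  by split; apply: le_lt_trans ltgD; rewrite ?ler_norm // -normrN ler_norm.
move=> [gD NgD]; move: sD; set t := Num.sqrt D in gD NgD * => sD.
have ea : a = (t ^+ 2 - g ^+ 2) / b by rewrite sD /D; field; rewrite gt_eqF.
exists ((g + t) / b), ((t - g) / b).
have bN : b != 0 by rewrite gt_eqF.
split; rewrite ?ea; try (by field).
- by rewrite divr_gt0 //; lra.
- by rewrite divr_gt0 //; lra.
Qed.

Lemma bform_delta (R : comPzRingType) n (M : 'M[R]_n) i j :
  bform M (delta_mx i 0) (delta_mx j 0) = M i j.
Proof. by rewrite /bform trmx_delta -rowE -colE !mxE. Qed.

(** Polarization at sums of two basis vectors. *)
Lemma bform_diag_neq0 (R : numFieldType) n (M : 'M[R]_n) :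
  M^T = M -> M != 0 -> exists u : 'cV[R]_n, bform M u u != 0.
Proof.
move=> symM; apply: contraNP => /forallNP M0; apply/eqP/matrixP => i j.
have q0 u : bform M u u = 0 by apply/eqP/negPn/negP/M0.
have := q0 (delta_mx i 0 + delta_mx j 0).
rewrite bformDl !bformDr !q0 (bformC (delta_mx j 0)) // add0r addr0 mxE.
by rewrite bform_delta -mulr2n => /eqP; rewrite mulrn_eq0 /= => /eqP.
Qed.

Lemma cV_dot_eq0 (R : realDomainType) n (v : 'cV[R]_n) :
  ((v^T *m v) 0 0 == 0) = (v == 0).
Proof.
apply/idP/eqP => [|->]; last by rewrite mulmx0 mxE.
rewrite mxE psumr_eq0 => [/allP v0|i _]; last by rewrite mxE -expr2 sqr_ge0.
apply/matrixP => i j; have := v0 i (mem_index_enum i).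
by rewrite /= !mxE -expr2 sqrf_eq0 ord1 => /eqP.
Qed.

(** * Finsler's lemma with an equality constraint *)

Section Finsler.
Context {R : realType} {n : nat}.
Implicit Types (M N : 'M[R]_n) (X Y : 'cV[R]_n).

Lemma bform_ray M X Y r : M^T = M ->
  bform M (X + r *: Y) (X + r *: Y) =
  bform M X X + 2 * r * bform M X Y + r ^+ 2 * bform M Y Y.
Proof.
move=> symM; rewrite bformDl !bformDr !bformZl !bformZr (bformC Y X) //; ring.
Qed.

(* A vector X with N(X) > 0 and a vector Y with N(Y) < 0 span a plane
   containing two null directions of N, on opposite sides of X; averaging M
   over them cancels the cross term M(X, Y). *)
Lemma null_plane_comparison M N X Y : M^T = M -> N^T = N ->
  (forall Z, bform N Z Z = 0 -> 0 <= bform M Z Z) ->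
  0 < bform N X X -> bform N Y Y < 0 ->
  - bform M X X / bform N X X <= - bform M Y Y / bform N Y Y.
Proof.
move=> symM symN M_ge0 X_gt0 Y_lt0.
have NY_gt0 : 0 < - bform N Y Y by rewrite oppr_gt0.
have [s1 [s2 [s1_gt0 s2_gt0 r1 r2 s12]]] :=
  opposite_sign_roots (bform N X Y) X_gt0 NY_gt0.
have := M_ge0 (X + s1 *: Y); rewrite !bform_ray // => ge1.
have := M_ge0 (X + (- s2) *: Y); rewrite !bform_ray // => ge2.
have {}ge1 := ge1 ltac:(rewrite -[RHS]r1; ring).
have {}ge2 := ge2 ltac:(rewrite -[RHS]r2; ring).
have sum_ge0 : 0 <= (s1 + s2) * (bform M X X + s1 * s2 * bform M Y Y).
  have := addr_ge0 (mulr_ge0 (ltW s2_gt0) ge1) (mulr_ge0 (ltW s1_gt0) ge2).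
  by congr (0 <= _); ring.
rewrite pmulr_rge0 ?addr_gt0 // in sum_ge0.
(* With denominators cleared and [bform N X X] replaced through [s12], the claim is [sum_ge0] times
   [- bform N Y Y]. *)
rewrite ler_pdivrMr // mulrAC ler_ndivlMr // -[bform N X X]s12.
have := mulr_ge0 (ltW NY_gt0) sum_ge0; lra.
Qed.

(** [X] makes the set of ratios nonempty and [Y] bounds it above, so the supremum exists and serves
    as [mu]. *)
Lemma finsler_equality M N X Y : M^T = M -> N^T = N ->
  (forall Z, bform N Z Z = 0 -> 0 <= bform M Z Z) ->
  0 < bform N X X -> bform N Y Y < 0 ->
  exists mu, forall Z, 0 <= bform M Z Z + mu * bform N Z Z.
Proof.
move=> symM symN M_ge0 X_gt0 Y_lt0.
pose S := [set - bform M Z Z / bform N Z Z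
  | Z in [set Z | 0 < bform N Z Z]]%classic.
have Sub Z : bform N Z Z < 0 -> ubound S (- bform M Z Z / bform N Z Z).
  by move=> Z_lt0 _ [W W_gt0 <-]; apply: null_plane_comparison.
have S0 : (S !=set0)%classic by exists (- bform M X X / bform N X X); exists X.
exists (sup S) => Z; case: (ltgtP (bform N Z Z) 0) => [Z_lt0|Z_gt0|Z0].
- have := ge_sup S0 (Sub Z Z_lt0); rewrite ler_ndivlMr //; lra.
- have : - bform M Z Z / bform N Z Z <= sup S.
    apply: ub_le_sup; last by exists Z.
    by exists (- bform M Y Y / bform N Y Y); apply: Sub.
  rewrite ler_pdivrMr //; lra.
- by rewrite Z0 mulr0 addr0 M_ge0.
Qed.

End Finsler.

(** * Null directions of the constraint *)

Section NullDirections.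
Context {R : realType} {n : nat} (A B : 'M[R]_n) (a b : 'cV[R]_n) (c d : R).
Hypotheses (symA : A^T = A) (symB : B^T = B).
Local Notation f := (quadfun A a c).
Local Notation h := (quadfun B b d).

Lemma quadfun_ray (M : 'M[R]_n) v k (w z : 'cV[R]_n) r : M^T = M ->
  quadfun M v k (w + r *: z) = quadfun M v k w
    + 2 * r * (bform M z w + (v^T *m z) 0 0) + r ^+ 2 * bform M z z.
Proof.
move=> symM; rewrite /quadfun -!/(bform _ _ _) bform_ray // (bformC w) //.
have -> : (v^T *m (w + r *: z)) 0 0 = (v^T *m w) 0 0 + r * (v^T *m z) 0 0.
  by rewrite mulmxDr -scalemxAr mxE [X in _ + X]mxE.
ring.
Qed.

Hypothesis E1 : forall x, h x = 0 -> 0 <= f x.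

Lemma null_direction_ge0 z x0 :
  B != 0 -> h x0 = 0 -> bform B z z = 0 -> 0 <= bform A z z.
Proof.
move=> B0 hx0 Bzz; set q := bform A z z.
pose l w := bform B z w + (b^T *m z) 0 0.
pose m w := bform A z w + (a^T *m z) 0 0.
(* The whole line [w + r *: z] lies in [h = 0], and [q] is the leading coefficient of [f] on it. *)
have line w : l w = 0 -> h w = 0 -> 0 <= q.
  move=> lw hw; apply: (@quadratic_lead_ge0 R q (2 * m w) (f w)) => r.
  have := @E1 (w + r *: z); rewrite !quadfun_ray // -/(l w) -/(m w) -/q.
  rewrite hw lw Bzz => /(_ ltac:(ring)); congr (0 <= _); ring.
(* The point w - h(w) / (2 l(w)) z lies on h = 0. *)
have key w : l w != 0 -> 0 <= 4 * l w ^+ 2 * f w - 4 * h w * l w * m w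
                              + h w ^+ 2 * q.
  move=> lw; have := @E1 (w + (- (h w / (2 * l w))) *: z).
  rewrite !quadfun_ray // -/(l w) -/(m w) -/q Bzz.
  move=> /(_ ltac:(field; exact: lw)) /(mulr_ge0 (sqr_ge0 (2 * l w))).
  by congr (0 <= _); field.
(* Limits are taken as values at 0 of polynomials in [e], with factors [P2]. *)
pose P2 (x y k : R) : {poly R} := x%:P + y *: 'X + k *: 'X^2.
have P2E x y k e : (P2 x y k).[e] = x + y * e + k * e ^+ 2.
  by rewrite /P2 !hornerE.
have [Bz0|Bz0] := eqVneq (B *m z) 0.
  have Bz w : bform B z w = 0.
    by rewrite bformC // /bform -mulmxA Bz0 mulmx0 mxE.
  have [bz0|bz0] := eqVneq ((b^T *m z) 0 0) 0.
    by apply: (line x0) => //; rewrite /l Bz bz0 addr0.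
  (* l is constant; take w = u / e with u^T B u != 0 and let e tend to 0. *)
  have [u Bu] := bform_diag_neq0 symB B0.
  set t := bform B u u in Bu; set be := (b^T *m z) 0 0 in bz0.
  (* [p.[e]] is [e ^+ 4] times the quantity of [key] at [e^-1 *: u]. *)
  pose p := 4 * be ^+ 2 *: ('X^2 * P2 (bform A u u) (2 * (a^T *m u) 0 0) c)
    - 4 * be *: ('X * P2 t (2 * (b^T *m u) 0 0) d
                  * P2 (bform A z u) ((a^T *m z) 0 0) 0)
    + q *: P2 t (2 * (b^T *m u) 0 0) d ^+ 2.
  suff: 0 <= p.[0].
    have -> : p.[0] = q * t ^+ 2.
      by rewrite /p !(hornerD, hornerN, hornerZ, hornerM, hornerX,
        hornerXn, horner_exp, hornerC, P2E); ring.
    by rewrite pmulr_lge0 // exprn_even_gt0.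
  apply: poly_ge0_at0 => e e0.
  have eu v k M : quadfun M v k (e^-1 *: u) =
      bform M u u / e ^+ 2 + 2 * (v^T *m u) 0 0 / e + k.
    rewrite /quadfun -!/(bform _ _ _) bformZl bformZr -scalemxAr mxE; field.
    exact: e0.
  have lE : l (e^-1 *: u) = be by rewrite /l Bz add0r.
  have := key (e^-1 *: u); rewrite lE !eu /m bformZr => /(_ bz0).
  move=> /(mulr_ge0 (sqr_ge0 (e ^+ 2))); congr (0 <= _).
  by rewrite /p !(hornerD, hornerN, hornerZ, hornerM, hornerX,
    hornerXn, horner_exp, hornerC, P2E) -/t -/q; field.
(* Let w tend, in the direction u = B z, to a zero w1 of l. *)
pose u := B *m z.
(* This number is the squared norm of [B *m z]. *)
have k0 : bform B z u != 0.
  apply: contra_neq Bz0; rewrite /bform -{1}symB -trmx_mul => /eqP.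
  by rewrite cV_dot_eq0 => /eqP.
set k := bform B z u in k0.
have [w1 l1] : exists w1, forall e, l (w1 + e *: u) = e * k.
  exists (- ((b^T *m z) 0 0 / k) *: u) => e.
  by rewrite /l bformDr !bformZr -/k; field.
have [hw1|hw1] := eqVneq (h w1) 0.
  by apply: (line w1) => //; rewrite -[w1]addr0 -(scale0r u) l1 mul0r.
(* Now [p.[e]] is the quantity of [key] at [w1 + e *: u], where [l] equals [e * k]. *)
pose p := 4 * k ^+ 2 *: ('X^2 * P2 (f w1) (2 * (bform A u w1 + (a^T *m u) 0 0))
                                  (bform A u u))
  - 4 * k *: ('X * P2 (h w1) (2 * (bform B u w1 + (b^T *m u) 0 0)) (bform B u u)
                * P2 (m w1) (bform A z u) 0)
  + q *: P2 (h w1) (2 * (bform B u w1 + (b^T *m u) 0 0)) (bform B u u) ^+ 2.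
suff: 0 <= p.[0].
  have -> : p.[0] = q * h w1 ^+ 2.
    by rewrite /p !(hornerD, hornerN, hornerZ, hornerM, hornerX,
      hornerXn, horner_exp, hornerC, P2E); ring.
  by rewrite pmulr_lge0 // exprn_even_gt0.
apply: poly_ge0_at0 => e e0; have := key (w1 + e *: u).
rewrite l1 mulf_neq0 // => /(_ isT); congr (0 <= _).
rewrite !quadfun_ray // /m bformDr bformZr.
rewrite /p !(hornerD, hornerN, hornerZ, hornerM, hornerX,
  hornerXn, horner_exp, hornerC, P2E) -/(m w1) /m; ring.
Qed.

End NullDirections.

(** * Homogenization in one more variable *)

Lemma bform_block (R : comPzRingType) k (P : 'M[R]_k) (q : 'cV[R]_k) s y t :
  let X := col_mx y t%:M in
  bform (block_mx P q q^T s%:M) X X =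
    bform P y y + 2 * t * (q^T *m y) 0 0 + s * t ^+ 2.
Proof.
have tr11 (x : 'M[R]_1) : x^T = x by apply/matrixP => i j; rewrite mxE !ord1.
rewrite /= /bform tr_col_mx mul_row_block mul_row_col !mulmxDl tr_scalar_mx.
rewrite !mul_mx_scalar !mul_scalar_mx -!scalemxAl.
rewrite -[y^T *m q]tr11 trmx_mul trmxK !mxE eqxx mulr1n; ring.
Qed.

Lemma col_mx_scalarP (R : pzSemiRingType) k (X : 'cV[R]_(k + 1)) :
  exists y t, X = col_mx y t%:M.
Proof.
by exists (usubmx X), (dsubmx X 0 0); rewrite -mx11_scalar vsubmxK.
Qed.

Section Homogenization.
Context {R : realType} {n : nat}.
Implicit Types (M A B : 'M[R]_n) (a b : 'cV[R]_n).

Definition hom_mx M v k : 'M[R]_(n + 1) := block_mx M v v^T k%:M.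

Lemma hom_mx_sym M v k : M^T = M -> (hom_mx M v k)^T = hom_mx M v k.
Proof. by move=> symM; rewrite tr_block_mx trmxK tr_scalar_mx symM. Qed.

Lemma bform_hom0 M v k y :
  bform (hom_mx M v k) (col_mx y 0%:M) (col_mx y 0%:M) = bform M y y.
Proof. by rewrite bform_block; ring. Qed.

Lemma bform_homZ M v k y t : t != 0 ->
  bform (hom_mx M v k) (col_mx y t%:M) (col_mx y t%:M) =
  t ^+ 2 * quadfun M v k (t^-1 *: y).
Proof.
move=> t0; rewrite bform_block /quadfun -!/(bform _ _ _) bformZl bformZr.
have -> : (v^T *m (t^-1 *: y)) 0 0 = t^-1 * (v^T *m y) 0 0.
  by rewrite -scalemxAr mxE.
by field.
Qed.

Lemma bform_hom1 M v k y :
  bform (hom_mx M v k) (col_mx y 1%:M) (col_mx y 1%:M) = quadfun M v k y.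
Proof. by rewrite bform_homZ ?oner_neq0 // invr1 expr1n scale1r mul1r. Qed.

(** Intermediate value theorem on the segment from [x'] to [x'']. *)
Lemma quadfun_zero B b d x' x'' : B^T = B ->
  quadfun B b d x' < 0 -> 0 < quadfun B b d x'' ->
  exists x, quadfun B b d x = 0.
Proof.
move=> symB h'lt0 h''gt0; set z := x'' - x'.
pose p : {poly R} := (quadfun B b d x')%:P
  + (2 * (bform B z x' + (b^T *m z) 0 0)) *: 'X + bform B z z *: 'X^2.
have pE r : p.[r] = quadfun B b d (x' + r *: z).
  rewrite quadfun_ray // !(hornerD, hornerZ, hornerC, hornerX, hornerXn).
  by ring.
have [] := @poly_ivt R p 0 1 ler01.
  by rewrite !pE scale0r scale1r addr0 addrC subrK !ltW.
by move=> r _ /rootP; rewrite pE; exists (x' + r *: z).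
Qed.

(** Finsler's lemma for the homogenizations: vectors with last entry [t != 0] rescale to zeros of
    the constraint, and those with [t = 0] are null directions of [B]. *)
Lemma S_lemma_equality A B a b c d x' x'' : A^T = A -> B^T = B ->
  quadfun B b d x' < 0 -> 0 < quadfun B b d x'' ->
  (forall x, quadfun B b d x = 0 -> 0 <= quadfun A a c x) ->
  (forall z, bform B z z = 0 -> 0 <= bform A z z) ->
  exists mu, forall x, 0 <= quadfun A a c x + mu * quadfun B b d x.
Proof.
move=> symA symB h'lt0 h''gt0 E1 Einf.
have [||Z||//|mu mu_ge0] := @finsler_equality R _ (hom_mx A a c) (hom_mx B b d)
    (col_mx x'' 1%:M) (col_mx x' 1%:M); rewrite ?hom_mx_sym ?bform_hom1 //.
  have [y [t ->]] := col_mx_scalarP Z.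
  have [->|t0] := eqVneq t 0; first by rewrite !bform_hom0; apply: Einf.
  rewrite !bform_homZ // => /eqP; rewrite mulf_eq0 sqrf_eq0 (negbTE t0) /=.
  by move=> /eqP /E1; apply/mulr_ge0/sqr_ge0.
by exists mu => x; have := mu_ge0 (col_mx x 1%:M); rewrite !bform_hom1.
Qed.

End Homogenization.

(** * Diagonalization of real symmetric matrices *)

Lemma sym_diagonalizable (R : rcfType) n (A : 'M[R]_n) : A^T = A ->
  exists2 P : 'M[R]_n, P \in unitmx & exists D, P *m A = diag_mx D *m P.
Proof.
move=> symA; pose rc := real_complex R.
pose toC m k : 'M[R]_(m, k) -> 'M[complex R]_(m, k) := map_mx rc.
have toC_real m k (M : 'M[R]_(m, k)) : toC _ _ M \is a realmx.
  by apply/mxOverP => i j; rewrite mxE; apply/complex_realP; exists (M i j).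
have real_toC m k (M : 'M[complex R]_(m, k)) :
    M \is a realmx -> exists N, M = toC _ _ N.
  move=> /mxOverP realM; exists (map_mx (@complex.Re R) M).
  by apply/matrixP => i j; rewrite !mxE; apply/esym/RRe_real.
have hermA : toC _ _ A \is hermsymmx.
  apply: realsym_hermsym => //; apply/is_hermitianmxP.
  by rewrite expr0 scale1r map_mx_id // /toC map_trmx symA.
have [D defD] := real_toC _ _ _ (hermitian_spectral_diag_real hermA).
have /orthomx_spectralP := hermitian_normalmx hermA; rewrite defD.
set P := spectralmx _ => defA.
have unitP : P \in unitmx := spectral_unit _.
(* Real matrices similar over the complex numbers are similar over the reals; the real basis
   obtained need not be orthogonal. *)
have [||| Q] := @real_similar _ n (toC _ _ A) (toC _ _ (diag_mx D)).
- exists P => //; apply/similarP => //.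
  by rewrite defA mulmxA mulmxA mulmxV // mul1mx /toC map_diag_mx.
- exact: toC_real.
- exact: toC_real.
rewrite inE => /andP[/real_toC [N ->]] unitN /(similarP unitN) eqN.
exists N; first by move: unitN; rewrite /toC map_unitmx.
by exists D; move: eqN; rewrite /toC -!map_mxM => /map_mx_inj.
Qed.

Lemma similar_char_poly (F : fieldType) n (P A B : 'M[F]_n) :
  P \in unitmx -> P *m A = B *m P -> char_poly A = char_poly B.
Proof.
move=> unitP eqPA; pose PC := map_mx (@polyC F) P.
have PC0 : \det PC != 0.
  by rewrite /PC det_map_mx polyC_eq0 -unitfE -unitmxE.
apply: (mulfI PC0); rewrite /char_poly -det_mulmx [RHS]mulrC -det_mulmx.
rewrite /char_poly_mx mulmxBr mulmxBl -!map_mxM eqPA.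
by rewrite scalar_mxC.
Qed.

Lemma char_poly_diag_mx (R : comNzRingType) n (D : 'rV[R]_n) :
  char_poly (diag_mx D) = \prod_(i < n) ('X - (D 0 i)%:P).
Proof.
rewrite char_poly_trig; last exact/diag_mx_is_trig.
by apply: eq_bigr => i _; rewrite mxE eqxx mulr1n.
Qed.

(** * Signs of the eigenvalues *)

Section SymmetricSpectrum.
Context {R : realType} {n : nat} (A P : 'M[R]_n) (D : 'rV[R]_n).
Hypotheses (symA : A^T = A) (unitP : P \in unitmx)
  (eigP : P *m A = diag_mx D *m P).

(** Gram matrix of the row eigenvectors; it stands in for the identity, as [P] need not be
    orthogonal. *)
Let G := P *m P^T.

(** [diag_mx D *m G] equals the symmetric matrix [P *m A *m P^T], so [diag_mx D] and [G] commute;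
    eigenvectors for distinct eigenvalues are thus orthogonal. *)
Lemma eigenbasis_gramC i j : D 0 i * G i j = G i j * D 0 j.
Proof.
have /matrixP/(_ i j) : diag_mx D *m G = G *m diag_mx D.
  have DG : diag_mx D *m G = P *m A *m P^T by rewrite /G mulmxA eigP.
  have <- : (diag_mx D *m G)^T = G *m diag_mx D.
    by rewrite trmx_mul tr_diag_mx /G trmx_mul trmxK.
  by rewrite DG !trmx_mul trmxK symA mulmxA.
by rewrite mul_diag_mx mul_mx_diag !mxE.
Qed.

Lemma bform_eigenbasis y :
  bform A (P^T *m y) (P^T *m y) = (y^T *m diag_mx D *m G *m y) 0 0.
Proof.
by rewrite /bform /G trmx_mul trmxK -!mulmxA (mulmxA P A) eigP !mulmxA.
Qed.

Lemma gram_gt0 x : x != 0 -> 0 < bform G x x.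
Proof.
move=> x0; have -> : bform G x x = ((P^T *m x)^T *m (P^T *m x)) 0 0.
  by rewrite /bform trmx_mul trmxK /G !mulmxA.
rewrite lt_neqAle eq_sym cV_dot_eq0; apply/andP; split; last first.
  by rewrite mxE sumr_ge0 // => i _; rewrite mxE -expr2 sqr_ge0.
apply: contra_neq x0 => Px0.
by rewrite -[x](@mulKmx _ _ _ P^T) ?unitmx_tr // Px0 mulmx0.
Qed.

(* The Gram matrix G commutes with D, hence with sqrt D, so that
   y^T D G y = |P^T (sqrt D) y|^2. *)
Lemma eigenvalues_ge0_psd :
  (forall i, 0 <= D 0 i) -> forall z, 0 <= bform A z z.
Proof.
move=> D_ge0 z; rewrite -[z](@mulKVmx _ _ _ P^T) ?unitmx_tr //.
set y := invmx _ *m z; rewrite bform_eigenbasis.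
pose S := diag_mx (map_mx Num.sqrt D).
have SS : S *m S = diag_mx D.
  apply/matrixP => i j; rewrite mulmx_diag !mxE.
  by rewrite -expr2 sqr_sqrtr.
have SG : S *m G = G *m S.
  apply/matrixP => i j; move: (eigenbasis_gramC i j); move: G => H gramC.
  rewrite mul_diag_mx mul_mx_diag !mxE.
  (* A nonzero Gram entry forces equal eigenvalues, hence equal square roots. *)
  have [->|Hij] := eqVneq (H i j) 0; first by rewrite mulr0 mul0r.
  suff -> : D 0 i = D 0 j by rewrite mulrC.
  by apply: (mulIf Hij); rewrite gramC mulrC.
have -> : y^T *m diag_mx D *m G *m y
        = (P^T *m S *m y)^T *m (P^T *m S *m y).
  have DG : diag_mx D *m G = S *m (G *m S) by rewrite -SS -(mulmxA S S) SG.
  transitivity (y^T *m (diag_mx D *m G) *m y); first by rewrite !mulmxA.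
  by rewrite DG !trmx_mul tr_diag_mx trmxK /G !mulmxA.
by rewrite mxE sumr_ge0 // => i _; rewrite mxE -expr2 sqr_ge0.
Qed.

(* Two eigenvectors for negative eigenvalues have a nontrivial combination in
   the hyperplane b^T x = 0, where A would be negative. *)
Lemma negative_eigenvalue_unique (b : 'cV[R]_n) i j :
  (forall x, (b^T *m x) 0 0 = 0 -> 0 <= bform A x x) ->
  D 0 i < 0 -> D 0 j < 0 -> i = j.
Proof.
move=> A_ge0 Di Dj; apply/eqP/negPn/negP => neq_ij.
pose v k : 'cV[R]_n := P^T *m delta_mx k 0.
have [s [t [st_neq0 st_null]]] : exists s t, (s, t) != 0
    /\ s * (b^T *m v i) 0 0 + t * (b^T *m v j) 0 0 = 0.
  have [bj|bj] := eqVneq ((b^T *m v j) 0 0) 0.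
    exists 0, 1; split; last by rewrite bj; ring.
    by rewrite xpair_eqE oner_eq0 andbF.
  exists ((b^T *m v j) 0 0), (- (b^T *m v i) 0 0); split; last by ring.
  by rewrite xpair_eqE negb_and bj.
pose y : 'cV[R]_n := s *: delta_mx i 0 + t *: delta_mx j 0.
have := A_ge0 (P^T *m y); rewrite leNgt.
have -> : (b^T *m (P^T *m y)) 0 0 = 0.
  by rewrite /y !mulmxDr -!scalemxAr mxE [X in X + _]mxE [X in _ + X]mxE.
move=> /(_ erefl) /negP; apply.
have Av k x : bform A (v k) (P^T *m x) = D 0 k * (G *m x) k 0.
  rewrite /bform /v trmx_mul trmxK trmx_delta -!mulmxA (mulmxA P A) eigP.
  rewrite -!mulmxA (mulmxA P) -/G -rowE mul_diag_mx.
  by rewrite !mxE.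
have yE : P^T *m y = s *: v i + t *: v j.
  by rewrite /y mulmxDr -!scalemxAr.
have Gy : forall k, (G *m y) k 0 = s * G k i + t * G k j.
  by move=> k; rewrite /y mulmxDr -!scalemxAr -!colE !mxE.
have -> : bform A (P^T *m y) (P^T *m y) =
    s ^+ 2 * (D 0 i * G i i) + t ^+ 2 * (D 0 j * G j j)
    + s * t * (D 0 i * G i j + D 0 j * G j i).
  by rewrite {1}yE bformDl !bformZl !Av !Gy; ring.
(* For equal eigenvalues the value is [D 0 i * bform G y y]; for distinct ones the cross entries of
   [G] vanish, leaving two nonpositive terms, one of them negative. *)
have [Dij|Dij] := eqVneq (D 0 i) (D 0 j).
  have -> : s ^+ 2 * (D 0 i * G i i) + t ^+ 2 * (D 0 j * G j j)
      + s * t * (D 0 i * G i j + D 0 j * G j i) = D 0 i * bform G y y.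
    rewrite /y bformDl !bformDr !bformZl !bformZr !bform_delta -Dij; ring.
  rewrite nmulr_rlt0 // gram_gt0 //; apply: contraNneq st_neq0 => y0.
  have ys k : y k 0 = s * (k == i)%:R + t * (k == j)%:R.
    by rewrite /y !mxE !andbT.
  have := ys i; have := ys j; rewrite y0 !mxE !eqxx eq_sym (negbTE neq_ij).
  by rewrite !mulr1 !mulr0 add0r addr0 => <- <-.
have G0 k l : D 0 k != D 0 l -> G k l = 0.
  move=> Dkl; apply/eqP; apply: contraNT Dkl => Gkl; apply/eqP/(mulIf Gkl).
  by rewrite eigenbasis_gramC mulrC.
rewrite (G0 i j) // (G0 j i) 1?eq_sym // !mulr0 addr0 mulr0 addr0.
have G_gt0 k : 0 < G k k.
  rewrite -bform_delta gram_gt0 //; apply/eqP => /matrixP/(_ k 0)/eqP.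
  by rewrite !mxE !eqxx oner_eq0.
have le0 k r : D 0 k < 0 -> r ^+ 2 * (D 0 k * G k k) <= 0.
  by move=> Dk; rewrite mulr_ge0_le0 ?sqr_ge0 // mulr_le0_ge0 // ltW.
have lt0 k r : D 0 k < 0 -> r != 0 -> r ^+ 2 * (D 0 k * G k k) < 0.
  by move=> Dk r0; rewrite pmulr_rlt0 ?exprn_even_gt0 // nmulr_rlt0.
move: st_neq0; rewrite xpair_eqE negb_and => /orP[s0|t0].
  by rewrite ltr_wnDr ?le0 ?lt0.
by rewrite ltr_wnDl ?le0 ?lt0.
Qed.

(** [negative_eigenvalue_unique] compares indices, so it yields both uniqueness of the negative
    eigenvalue and its simplicity as a root. *)
Lemma one_neg_eigenvalue_of_eigenbasis (b z : 'cV[R]_n) :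
  (forall x, (b^T *m x) 0 0 = 0 -> 0 <= bform A x x) ->
  bform A z z < 0 -> one_neg_eigenvalue A.
Proof.
move=> A_ge0 z_lt0.
have [i Di] : exists i, D 0 i < 0.
  apply: contrapT => /forallNP D_ge0; move: z_lt0; rewrite ltNge.
  by rewrite eigenvalues_ge0_psd // => i; rewrite leNgt; apply/negP/D_ge0.
have DE : char_poly A = \prod_(k < n) ('X - (D 0 k)%:P).
  by rewrite (similar_char_poly unitP eigP) char_poly_diag_mx.
have eigE l : l < 0 -> eigenvalue A l -> l = D 0 i.
  rewrite eigenvalue_root_char DE rootE horner_prod => l_lt0.
  move=> /prodf_eq0[k _]; rewrite hornerXsubC subr_eq0 => /eqP lE.
  rewrite lE; congr (D 0 _).
  by apply: (negative_eigenvalue_unique A_ge0 _ Di); rewrite -lE.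
exists (D 0 i); split => //.
  rewrite eigenvalue_root_char DE rootE horner_prod (bigD1 i) //=.
  by rewrite hornerXsubC subrr mul0r.
rewrite DE (bigD1 i) //= mupMl; first by rewrite (@mup_XsubCX _ 1) eqxx.
rewrite rootE horner_prod; apply/prodf_neq0 => k neq_ki.
rewrite hornerXsubC subr_eq0; apply: contra neq_ki => /eqP Dk.
by apply/eqP/(negative_eigenvalue_unique A_ge0 _ Di); rewrite -Dk.
Qed.

End SymmetricSpectrum.

Lemma one_neg_eigenvalue_of_hyperplane (R : realType) n (A : 'M[R]_n)
    (b z : 'cV[R]_n) : A^T = A ->
  (forall x, (b^T *m x) 0 0 = 0 -> 0 <= bform A x x) ->
  bform A z z < 0 -> one_neg_eigenvalue A.
Proof.
move=> symA; have [P unitP [D eigP]] := sym_diagonalizable symA.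
exact: (one_neg_eigenvalue_of_eigenbasis symA unitP eigP).
Qed.

Lemma one_neg_eigenvalue_neg_direction (R : realType) n (A : 'M[R]_n) :
  A^T = A -> one_neg_eigenvalue A -> exists z, bform A z z < 0.
Proof.
move=> symA [l [l_lt0 /eigenvalueP[v vA v0] _ _]]; exists v^T.
rewrite /bform trmxK vA -scalemxAl mxE nmulr_rlt0 //.
rewrite lt_neqAle eq_sym -{1}[v]trmxK cV_dot_eq0 trmx_eq0 v0 /=.
by rewrite mxE sumr_ge0 // => i _; rewrite mxE -expr2 sqr_ge0.
Qed.

(** * Affine constraint and bordered matrix *)

Section AffineConstraint.
Context {R : realType} {n k : nat} (A : 'M[R]_n) (a b : 'cV[R]_n) (c d : R).
Context (V : 'M[R]_(n, k)).
Implicit Types (x : 'cV[R]_n) (y : 'cV[R]_k).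
Hypotheses (symA : A^T = A) (b0 : b != 0) (basisV : cols_basis_null b V).
Local Notation f := (quadfun A a c).
Local Notation h := (quadfun 0 b d).
Local Notation x0 := (basepoint b d).

Lemma affine_quadfunE x : h x = 2 * (b^T *m x) 0 0 + d.
Proof. by rewrite /quadfun mulmx0 mul0mx mxE add0r. Qed.

Lemma basepoint_zero : h x0 = 0.
Proof.
have bb : (b^T *m b) 0 0 != 0 by rewrite cV_dot_eq0.
rewrite affine_quadfunE /basepoint -scalemxAr.
by set r := (b^T *m b) 0 0 in bb *; rewrite mxE -/r; field.
Qed.

Lemma null_basisP x : (b^T *m x) 0 0 = 0 <-> exists y, x = V *m y.
Proof.
have [_ /andP[VK KV]] := basisV.
have bx : ((b^T *m x) 0 0 = 0) <-> x^T *m b = 0.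
  have -> : x^T *m b = (b^T *m x)^T by rewrite trmx_mul trmxK.
  split=> [bx|/matrixP/(_ 0 0)]; last by rewrite mxE => ->; rewrite mxE.
  by apply/matrixP => i j; rewrite mxE !ord1 bx mxE.
split=> [/bx/sub_kermxP/submx_trans/(_ KV)/submxP[D defx]|[y xE]].
  by exists D^T; rewrite -[x]trmxK defx trmx_mul trmxK.
apply/bx/sub_kermxP/(submx_trans _ VK)/submxP; exists y^T.
by rewrite xE trmx_mul.
Qed.

Lemma affine_zeroP x : h x = 0 <-> exists y, x = V *m y + x0.
Proof.
have x0E : (b^T *m x0) 0 0 = - (d / 2).
  by have := basepoint_zero; rewrite affine_quadfunE; lra.
have bB : (b^T *m (x - x0)) 0 0 = (b^T *m x) 0 0 + d / 2.
  by rewrite mulmxBr [LHS]mxE [X in _ + X]mxE x0E opprK.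
have -> : h x = 0 <-> (b^T *m (x - x0)) 0 0 = 0.
  by rewrite affine_quadfunE bB; split; lra.
rewrite null_basisP; split=> -[y xE]; exists y; first by rewrite -xE subrK.
by rewrite xE addrK.
Qed.

(** The bordered matrix is the pullback of the homogenized [f] along
    [(y, t) |-> (V y + t x0, t)]. *)
Lemma bform_bordered y t :
  bform (bordered_mx A a c V x0) (col_mx y t%:M) (col_mx y t%:M) =
  bform (hom_mx A a c) (col_mx (V *m y + t *: x0) t%:M)
                       (col_mx (V *m y + t *: x0) t%:M).
Proof.
have qT : (x0^T *m A + a^T) *m V = (V^T *m (A *m x0 + a))^T.
  by rewrite trmx_mul linearD /= trmx_mul symA trmxK.
rewrite /bordered_mx qT !bform_block bform_ray //.
have -> : bform (V^T *m A *m V) y y = bform A (V *m y) (V *m y).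
  by rewrite /bform trmx_mul !mulmxA.
have -> : ((V^T *m (A *m x0 + a))^T *m y) 0 0 =
    bform A (V *m y) x0 + (a^T *m (V *m y)) 0 0.
  rewrite bformC // /bform -qT mulmxDl mulmxDl mxE !mulmxA //.
have -> : (a^T *m (V *m y + t *: x0)) 0 0 =
    (a^T *m (V *m y)) 0 0 + t * (a^T *m x0) 0 0.
  by rewrite mulmxDr -scalemxAr [LHS]mxE [X in _ + X]mxE.
rewrite /quadfun -!/(bform _ _ _); ring.
Qed.

(** Vectors with nonzero last entry rescale to points of [h = 0]; the others are directions of that
    hyperplane, along which [f] has nonnegative leading coefficient. *)
Lemma bordered_psdP :
  psdmx (bordered_mx A a c V x0) <-> (forall x, h x = 0 -> 0 <= f x).
Proof.
split=> [[_ psd] x /affine_zeroP[y ->]|f_ge0].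
  have := psd (col_mx y 1%:M); rewrite -/(bform _ _ _) bform_bordered.
  by rewrite scale1r bform_hom1.
split=> [|X].
  rewrite /bordered_mx tr_block_mx tr_scalar_mx; congr block_mx.
  - by rewrite !trmx_mul trmxK symA mulmxA.
  - by rewrite trmx_mul linearD /= trmx_mul !trmxK symA.
  - by rewrite trmx_mul linearD /= trmx_mul trmxK symA.
have [y [t ->]] := col_mx_scalarP X; rewrite -/(bform _ _ _) bform_bordered.
have [->|t0] := eqVneq t 0; last first.
  rewrite bform_homZ // mulr_ge0 ?sqr_ge0 //; apply/f_ge0/affine_zeroP.
  exists (t^-1 *: y); rewrite -scalemxAr scalerDr scalerA mulVf //.
  by rewrite scale1r.
rewrite bform_hom0 scale0r addr0.
apply: (@quadratic_lead_ge0 R _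
  (2 * (bform A (V *m y) x0 + (a^T *m (V *m y)) 0 0)) (f x0)) => r.
have hr : h (x0 + r *: (V *m y)) = 0.
  by apply/affine_zeroP; exists (r *: y); rewrite -scalemxAr addrC.
have := f_ge0 _ hr; rewrite quadfun_ray //; congr (0 <= _); ring.
Qed.

End AffineConstraint.

Unset Implicit Arguments.

(* A basis of the null space of b with n-1 vectors exists only when b != 0, so
   V is constrained only then; it is otherwise an arbitrary choice of basis. *)
Theorem theorem3 (R : realType) (n : nat)
    (A B : 'M[R]_n) (a b : 'cV[R]_n) (c d : R) (V : 'M[R]_(n, n.-1))
    (symA : A^T = A) (symB : B^T = B)
    (hsign : exists x' x'' : 'cV[R]_n,
       quadfun B b d x' < 0 /\ 0 < quadfun B b d x'')
    (basisV : b != 0 -> cols_basis_null b V) :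
  let f := quadfun A a c in
  let h := quadfun B b d in
  let E1 := forall x : 'cV[R]_n, h x = 0 -> 0 <= f x in
  let E2 := exists mu : R, forall x : 'cV[R]_n, 0 <= f x + mu * h x in
  ~ (E1 <-> E2) <->
  [/\ one_neg_eigenvalue A, B = 0, b != 0
    & psdmx (bordered_mx A a c V (basepoint b d))].
Proof.
move=> f h E1 E2; have [x' [x'' [h'_lt0 h''_gt0]]] := hsign.
have E21 : E2 -> E1.
  by move=> [mu ge0] x hx; have := ge0 x; rewrite hx mulr0 addr0.
split=> [notE|[negA B0 b0 psd]]; last first.
  have e1 : E1.
    by rewrite /E1 /h B0; apply/(bordered_psdP a c d symA b0 (basisV b0)).
  move=> [/(_ e1)[mu ge0] _].
  have [z] := one_neg_eigenvalue_neg_direction symA negA.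
  rewrite ltNge => /negP; apply.
  (* On the line spanned by [z], [f + mu h] has leading coefficient [bform A z z] since [B = 0]. *)
  apply: (@quadratic_lead_ge0 R _ (2 * (bform A z 0 + (a^T *m z) 0 0)
      + mu * (2 * (bform B z 0 + (b^T *m z) 0 0))) (f 0 + mu * h 0)) => r.
  have := ge0 (0 + r *: z); rewrite /f /h !quadfun_ray //.
  have -> : bform B z z = 0 by rewrite /bform B0 mulmx0 mul0mx mxE.
  by congr (0 <= _); ring.
have nE2 : ~ E2 by move=> e2; apply: notE.
have e1 : E1 by apply: contrapT => ne1; apply: notE.
have [z Bz Az] : exists2 z, bform B z z = 0 & bform A z z < 0.
  apply: contrapT => noz; apply: nE2.
  apply: (S_lemma_equality symA symB h'_lt0 h''_gt0 e1) => z Bz.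
  by rewrite leNgt; apply/negP => Az; apply: noz; exists z.
have [y hy] := quadfun_zero symB h'_lt0 h''_gt0.
have B0 : B = 0.
  apply/eqP/negPn/negP => nB0; move: Az; rewrite ltNge => /negP; apply.
  exact: (null_direction_ge0 symA symB e1 nB0 hy Bz).
have b0 : b != 0.
  (* Otherwise [h] would be constant, against its two signs. *)
  apply: contraTneq (lt_trans h'_lt0 h''_gt0) => b0.
  by rewrite B0 b0 !affine_quadfunE trmx0 !mul0mx ltxx.
have psd : psdmx (bordered_mx A a c V (basepoint b d)).
  apply/(bordered_psdP a c d symA b0 (basisV b0)) => x hx.
  by apply: e1; rewrite /h B0.
split=> //.
apply: (one_neg_eigenvalue_of_hyperplane (b := b) symA _ Az) => x bx.
(* The line [y + r *: x] stays in [h = 0], where [f] is nonnegative. *)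
apply: (@quadratic_lead_ge0 R _
  (2 * (bform A x y + (a^T *m x) 0 0)) (f y)) => r.
have := e1 (y + r *: x).
have form0 u v : bform (0 : 'M[R]_n) u v = 0.
  by rewrite /bform mulmx0 mul0mx mxE.
rewrite /h quadfun_ray // hy bx B0 !form0.
move=> /(_ ltac:(ring)); rewrite /f quadfun_ray //.
by congr (0 <= _); ring.
Qed.
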